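(* Let $n\ge1$ and let $(\xi_i,\mathcal{F}_i)_{i=0,\dots,n}$ be a sequence of real-valued martingale differences on $(\Omega,\mathcal{F},\mathbf{P})$ with $\xi_0=0$, $\{\emptyset,\Omega\}=\mathcal{F}_0\subseteq\cdots\subseteq\mathcal{F}_n\subseteq\mathcal{F}$ and $\mathbf{E}[\xi_i\mid\mathcal{F}_{i-1}]=0$. Let $S_k=\sum_{i=1}^k\xi_i$ and $\langle S\rangle_k=\sum_{i=1}^k\mathbf{E}[\xi_i^2\mid\mathcal{F}_{i-1}]$. Let $p\ge2$ and assume $\mathbf{E}[|\xi_i|^p]<\infty$ for all $i\in[1,n]$. Define $\Xi(S)_k=\sum_{i=1}^k\mathbf{E}[(\xi_i^+)^p\mid\mathcal{F}_{i-1}]$ for $k\in[1,n]$, and set $a=\frac{2}{p+2}$, $b=1-a$. Then for all $x,y,v,w>0$, $$\mathbf{P}\big(S_k\ge x,\ \langle S\rangle_k\le v \text{ and } \Xi(S)_k\le w \text{ for some } k\in[1,n]\big)\le \exp\Big\{-\frac{a^2x^2}{2e^pv}\Big\}+\exp\Big\{-\frac{bx}{y}\log\Big(1+\frac{bxy^{p-1}}{w}\Big)\Big\}+\mathbf{P}\Big(\max_{1\le i\le n}\xi_i>y\Big).$$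
   Context: $x^+=\max\{x,0\}$. (The paper denotes the constants $a,b$ by $\alpha,\beta$.) *)

(* Defs.v *)
From HB Require Import structures.
From mathcomp Require Import all_boot all_order all_algebra.
From mathcomp Require Import all_classical all_reals all_analysis.
Set Implicit Arguments. Unset Strict Implicit. Unset Printing Implicit Defensive.
Import Order.TTheory GRing.Theory Num.Theory.
Import numFieldNormedType.Exports.
Local Open Scope classical_set_scope.
Local Open Scope ring_scope.

Definition G_measurable d (T : measurableType d) (R : realType)
    (G : set (set T)) (g : T -> R) : Prop :=
  forall B : set R, measurable B -> G (g @^-1` B).

(* g is a version of the conditional expectation E[f | G] under P
   (G a sub-sigma-algebra of the ambient one, f integrable). *)
Definition cond_exp_version d (T : measurableType d) (R : realType)
    (P : probability T R) (G : set (set T)) (f g : T -> R) : Prop :=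
  [/\ G_measurable G g,
      P.-integrable setT (EFin \o g) &
      forall A, G A ->
        (\int[P]_(x in A) (g x)%:E = \int[P]_(x in A) (f x)%:E)%E].

Definition is_filtration d (T : measurableType d) (n : nat)
    (F : nat -> set (set T)) : Prop :=
  [/\ F 0%N = [set set0; setT],
      (forall i, (i <= n)%N -> sigma_algebra setT (F i)),
      (forall i, (i <= n)%N -> F i `<=` measurable) &
      (forall i, (i < n)%N -> F i `<=` F i.+1)].

Definition mart_diff d (T : measurableType d) (R : realType)
    (P : probability T R) (n : nat) (F : nat -> set (set T))
    (xi : nat -> T -> R) : Prop :=
  [/\ is_filtration n F,
      xi 0%N = (fun _ => 0),
      (forall i, (i <= n)%N -> G_measurable (F i) (xi i)),
      (forall i, (1 <= i <= n)%N -> P.-integrable setT (EFin \o xi i)) &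
      (forall i, (1 <= i <= n)%N -> cond_exp_version P (F i.-1) (xi i) (fun _ => 0))].

(* Main.v *)
(* Put [eta_i = xi_i 1_{xi_i <= y}]; on [max xi_i <= y] nothing changes. For
   [l > 0] one has pointwise
     [e^(l eta) <= 1 + l xi + c1 xi^2 + c2 (xi^+)^p],  [c1 = l^2 e^p / 2],
   with [c2 = (e^(l y) - 1 - l y) / y^p] if [l y > p] and [c2 = 0] otherwise: the
   quadratic term suffices where [l xi <= p], and [(e^t - 1 - t) / t^p] increases
   on [t >= p]. Hence [exp (l sum eta_i - c1 <S>_k - c2 Xi_k)] is a
   supermartingale, and stopping it gives the bound
   [exp (- l x + c1 v + c2 w)]. The choice
     [l = min (a x / (e^p v), ln (1 + b x y^(p-1) / w) / y)]
   makes this at most one of the two exponentials. *)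
Require Import Defs.
From HB Require Import structures.
From mathcomp Require Import all_boot all_order all_algebra.
From mathcomp Require Import all_classical all_reals all_analysis measurable_realfun.
From mathcomp Require Import ring lra.
Import Order.TTheory GRing.Theory Num.Theory.
Import numFieldNormedType.Exports.
Local Open Scope classical_set_scope.
Local Open Scope ring_scope.
Set Implicit Arguments.
Unset Strict Implicit.
Unset Printing Implicit Defensive.

(** * Elementary inequalities for the exponential and for real powers *)

Lemma expR_sub1_le (R : realType) (t : R) : expR t - 1 <= t * expR t.
Proof.
have h := expR_ge1Dx (- t); have e0 := expR_gt0 t.
have := ler_wpM2r (ltW e0) h.
by rewrite -expRD addNr expR0; lra.
Qed.

(** For [t < 0], [e^t (1 - t) <= 1 <= (1 + t + t^2) (1 - t)], and [e^p / 2 >= 1]. For [t >= 0] put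
    [s = t / 2]: then [e^t - 1 - t = (e^s - 1)^2 + 2 (e^s - 1 - s)], and both summands are at most
    [s^2 e^p]. *)
Lemma expR_le_quadratic (R : realType) (p t : R) : 2 <= p -> t <= p ->
  expR t <= 1 + t + expR p / 2 * t ^+ 2.
Proof.
move=> p2 tp; have ep := expR_gt0 p.
have [t0|t0] := leP 0 t; last first.
  have h := expR_ge1Dx (- t); have e2 := expR_ge1Dx p.
  have et := expR_gt0 t.
  have e1 : expR t * expR (- t) = 1 by rewrite -expRD subrr expR0.
  have : expR t <= 1 + t + t ^+ 2.
    suff : expR t * (1 - t) <= (1 + t + t ^+ 2) * (1 - t) by rewrite ler_pM2r //; lra.
    apply: (@le_trans _ _ 1); first by rewrite -[leRHS]e1 ler_pM2l.
    have : 0 <= (- t) * t ^+ 2 by rewrite mulr_ge0 ?sqr_ge0 // oppr_ge0 ltW.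
    by rewrite !expr2; lra.
  have := ler_wpM2r (sqr_ge0 t) (_ : 1 <= expR p / 2); lra.
pose s := t / 2; have ts : t = s + s by rewrite /s; lra.
have s0 : 0 <= s by rewrite /s; lra.
have e2 : 2 * expR s <= expR p.
  have : p = p / 2 + p / 2 by lra.
  move=> ->; rewrite expRD; apply: ler_pM => //; rewrite ?expR_ge0 //.
    by have := expR_ge1Dx (p / 2); lra.
  by rewrite ler_expR /s; lra.
have e3 : 2 * (expR s * expR s) <= 2 * expR p.
  by rewrite -expRD -ts ler_wpM2l // ler_expR.
have h1 := expR_sub1_le s.
have e1 := expR_ge1Dx s.
have h2 : (expR s - 1) ^+ 2 <= s ^+ 2 * (expR s * expR s).
  have : (expR s - 1) ^+ 2 <= (s * expR s) ^+ 2.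
    by rewrite ler_sqr ?nnegrE //; [lra | rewrite mulr_ge0 // expR_ge0].
  by rewrite exprMn (expr2 (expR s)).
have h3 : expR s - 1 - s <= s ^+ 2 * expR s.
  have := ler_wpM2l s0 h1; rewrite expr2 -mulrA; nra.
have -> : expR t = expR s * expR s by rewrite ts expRD.
have s2 := sqr_ge0 s.
have : s ^+ 2 * (2 * expR s) <= s ^+ 2 * expR p by rewrite ler_wpM2l.
have : s ^+ 2 * (2 * (expR s * expR s)) <= s ^+ 2 * (2 * expR p).
  by rewrite ler_wpM2l.
rewrite ts !expr2 in h2 h3 s2 *.
nra.
Qed.

(** Since [t / s <= e^(t / s - 1)], the power [(t / s)^p] is at most [e^(p (t - s) / s)], and
    [p <= s]. *)
Lemma powR_expR_le (R : realType) (p s t : R) : 0 < p -> p <= s -> s <= t ->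
  t `^ p <= expR (t - s) * s `^ p.
Proof.
move=> p0 ps st; have s0 : 0 < s by lra.
have t0 : 0 < t by lra.
have {1}-> : t = (t / s) * s by rewrite divfK // gt_eqF.
have ts0 : 0 <= t / s by rewrite divr_ge0 // ltW.
rewrite powRM //; last exact: ltW.
rewrite ler_wpM2r ?powR_ge0 //.
have h : t / s <= expR (t / s - 1) by have := expR_ge1Dx (t / s - 1); lra.
apply: (@le_trans _ _ (expR (t / s - 1) `^ p)).
  by apply: ge0_ler_powR; rewrite ?nnegrE ?expR_ge0 //; exact: ltW.
rewrite -expRM ler_expR.
have -> : t / s - 1 = (t - s) / s by rewrite mulrBl divff // gt_eqF.
rewrite -mulrA ler_piMr ?subr_ge0 // mulrC ler_pdivrMr //; lra.
Qed.

(** After [powR_expR_le] it remains to see [1 + t <= (1 + s) e^(t - s)], which follows from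
    [e^(t - s) >= 1 + (t - s)]. This is the monotonicity of [(e^t - 1 - t) / t^p] with denominators
    cleared. *)
Lemma expR_remainder_powR_le (R : realType) (p s t : R) :
  0 < p -> p <= s -> s <= t ->
  (expR s - 1 - s) * t `^ p <= (expR t - 1 - t) * s `^ p.
Proof.
move=> p0 ps st.
have h0 := powR_expR_le p0 ps st.
have h1 := expR_ge1Dx s; have h2 := expR_ge1Dx (t - s).
have e : expR t = expR s * expR (t - s) by rewrite -expRD; congr expR; lra.
apply: (@le_trans _ _ ((expR s - 1 - s) * (expR (t - s) * s `^ p))).
  by rewrite ler_wpM2l //; lra.
rewrite mulrA ler_wpM2r ?powR_ge0 // e; nra.
Qed.

(** * Pointwise bound on the truncated exponential, and the choice of [l] *)

Definition tail_coef (R : realType) (p y l : R) : R :=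
  if l * y <= p then 0 else (expR (l * y) - 1 - l * y) / y `^ p.

Lemma tail_coef_ge0 (R : realType) (p y l : R) : 0 <= tail_coef p y l.
Proof.
rewrite /tail_coef; case: ifP => // _; rewrite divr_ge0 ?powR_ge0 //.
by have := expR_ge1Dx (l * y); lra.
Qed.

(** Three cases. If [u > y], the left side is 1. If [l u <= p], the quadratic term suffices.
    Otherwise [p < l u <= l y], and the monotone remainder compares these two points; the common
    factor [l^p] cancels. *)
Lemma expR_trunc_le (R : realType) (p y l u : R) :
  2 <= p -> 0 < y -> 0 < l ->
  expR (l * (if u <= y then u else 0)) <=
  1 + l * u + l ^+ 2 * expR p / 2 * u ^+ 2 + tail_coef p y l * Num.max u 0 `^ p.
Proof.
move=> p2 y0 l0; have p0 : 0 < p by lra.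
have c0 := tail_coef_ge0 p y l; have w0 := powR_ge0 (Num.max u 0) p.
have cw := mulr_ge0 c0 w0; have ep := expR_gt0 p.
have q0 : 0 <= l ^+ 2 * expR p / 2 * u ^+ 2.
  by apply: mulr_ge0; rewrite ?sqr_ge0 // divr_ge0 // mulr_ge0 ?sqr_ge0 ?expR_ge0.
case: ifPn => uy; last first.
  rewrite mulr0 expR0; move: uy; rewrite -ltNge => uy.
  have : 0 <= l * u by rewrite mulr_ge0 //; lra.
  lra.
have [lup|lup] := leP (l * u) p.
  have := expR_le_quadratic p2 lup; rewrite exprMn; lra.
have u0 : 0 < u by rewrite -(pmulr_rgt0 _ l0); lra.
have luy : l * u <= l * y by rewrite ler_pM2l.
have -> : Num.max u 0 = u by apply/max_idPl; lra.
rewrite /tail_coef ifF; last by apply/negbTE; rewrite -ltNge; lra.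
suff : expR (l * u) - 1 - l * u <=
    (expR (l * y) - 1 - l * y) / y `^ p * u `^ p by lra.
have h := expR_remainder_powR_le p0 (ltW lup) luy.
rewrite mulrAC ler_pdivlMr ?powR_gt0 //.
rewrite !powRM in h; try exact: ltW.
by rewrite -(ler_pM2r (powR_gt0 p l0)); lra.
Qed.

(** The candidate [l1 = a x / (e^p v)] minimises [- l a x + l^2 e^p v / 2], while [l = t2 / y]
    solves [e^(l y) = 1 + c], where [c] satisfies [c w / y^p = b x / y]. The smaller of the two is
    taken. *)
Lemma exponent_choice (R : realType) (p x y v w : R) :
  2 <= p -> 0 < x -> 0 < y -> 0 < v -> 0 < w ->
  let a := 2 / (p + 2) in let b := 1 - a in
  exists2 l, 0 < l &
    expR (- (l * x - l ^+ 2 * expR p / 2 * v - tail_coef p y l * w)) <=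
    expR (- (a ^+ 2 * x ^+ 2) / (2 * expR p * v))
    + expR (- (b * x / y) * ln (1 + b * x * y `^ (p - 1) / w)).
Proof.
move=> p2 x0 y0 v0 w0 a b.
have p0 : 0 < p by lra.
have ep := expR_gt0 p.
have bE : b = a * p / 2 by rewrite /b /a; field; lra.
have a0 : 0 < a by rewrite /a divr_gt0 //; lra.
have b0 : 0 < b by rewrite bE divr_gt0 // mulr_gt0.
have yp := powR_gt0 p y0.
have yp1 : y `^ (p - 1) = y `^ p / y.
  by rewrite -(mulr_powRB1 (ltW y0) p0); field; rewrite gt_eqF.
pose c := b * x * y `^ (p - 1) / w.
have c0 : 0 < c by rewrite /c divr_gt0 // !mulr_gt0 // powR_gt0.
have cE : c * w / y `^ p = b * x / y.
  by rewrite /c yp1; field; rewrite !gt_eqF.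
rewrite -/c; set t2 := ln (1 + c).
have et2 : expR t2 = 1 + c by rewrite lnK // posrE; lra.
have t20 : 0 < t2 by rewrite ln_gt0 //; lra.
pose l1 := a * x / (expR p * v).
have l10 : 0 < l1 by rewrite /l1 divr_gt0 // mulr_gt0.
have l1E : l1 * (expR p * v) = a * x.
  by rewrite divfK // gt_eqF // mulr_gt0.
have A1 : - (a ^+ 2 * x ^+ 2) / (2 * expR p * v) = - (a * x * l1) / 2.
  by rewrite /l1; field; rewrite !gt_eqF.
clearbody l1.
have A2 : - (b * x / y) * t2 = - (b * x * (t2 / y)) by field; rewrite gt_eqF.
have l20 : 0 < t2 / y by rewrite divr_gt0.
(* With [x = a x + b x], each of the two terms of the exponent is controlled by
   its own share; for [l = t2 / y] and [t2 > p] this uses [b = a p / 2]. *)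
have [l12|l12] := leP l1 (t2 / y).
  exists l1 => //; rewrite -[leLHS]addr0 lerD ?expR_ge0 // ler_expR A1.
  have ly : l1 * y <= t2 by rewrite -ler_pdivlMr.
  (* From [e^s - 1 <= s e^s] and [l1 y <= t2], the remainder [e^(l1 y) - 1 - l1 y] is at most
     [l1 y (e^t2 - 1) = l1 y c]. *)
  have : tail_coef p y l1 * w <= b * x * l1.
    rewrite /tail_coef; case: ifP => _.
      by rewrite mul0r ltW // !mulr_gt0.
    have -> : b * x * l1 = (l1 * y * c) / y `^ p * w.
      transitivity (l1 * y * (c * w / y `^ p)); last by ring.
      by rewrite cE; field; rewrite gt_eqF.
    rewrite ler_pM2r // ler_pM2r ?invr_gt0 //.
    have h1 := expR_sub1_le (l1 * y).
    have h2 : l1 * y * expR (l1 * y) <= l1 * y * expR t2.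
      by rewrite ler_pM2l ?ler_expR // mulr_gt0.
    by rewrite et2 in h2; lra.
  have -> : l1 ^+ 2 * expR p / 2 * v = l1 * (l1 * (expR p * v)) / 2 by field.
  by rewrite l1E /b; lra.
exists (t2 / y) => //.
rewrite -[leLHS]add0r lerD ?expR_ge0 // ler_expR A2.
set l := t2 / y in l12 l20 *.
have lyE : l * y = t2 by rewrite divfK // gt_eqF.
clearbody l.
have h1 : l ^+ 2 * expR p / 2 * v <= l * (a * x) / 2.
  have -> : l ^+ 2 * expR p / 2 * v = l * (l * (expR p * v)) / 2 by field.
  rewrite ler_pM2r ?invr_gt0 // ler_pM2l // -l1E ler_pM2r ?mulr_gt0 //.
  exact: ltW.
(* The quadratic term has used one half of the share [l a x]; the tail must fit in the other half.
   When [t2 > p] the tail is at most [b x / y = a p x / (2 y) < l a x / 2]; this balance is the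
   source of [a = 2 / (p + 2)]. *)
suff : tail_coef p y l * w <= l * (a * x) / 2 by rewrite /b; lra.
rewrite /tail_coef lyE; case: ifPn => [_|].
  by rewrite mul0r; have := mulr_gt0 l20 (mulr_gt0 a0 x0); lra.
rewrite -ltNge => pt.
have -> : expR t2 - 1 - t2 = c - t2 by rewrite et2; ring.
apply: (@le_trans _ _ (c * w / y `^ p)).
  by rewrite mulrAC ler_pM2r ?invr_gt0 // ler_pM2r //; lra.
rewrite cE bE ler_pdivrMr //.
have -> : l * (a * x) / 2 * y = l * y * (a * x) / 2 by ring.
rewrite lyE.
have : p * (a * x) <= t2 * (a * x) by rewrite ler_pM2r ?(ltW pt) // mulr_gt0.
lra.
Qed.

(** * Measurability and integration relative to a sub-sigma-algebra *)

Lemma G_measurableP d (T : measurableType d) (R : realType)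
    (G : set (set T)) (g : T -> R) : sigma_algebra setT G ->
  G_measurable G g <->
  measurable_fun setT (g : g_sigma_algebraType G -> R).
Proof.
move=> sG; split=> [mg _ B mB|mg B mB].
  by rewrite setTI /measurable /= sigma_algebra_id //; exact: mg.
have := mg measurableT B mB.
by rewrite setTI /measurable /= sigma_algebra_id.
Qed.

(** Like [G_measurableP], this moves to the type [g_sigma_algebraType G], where the closure
    properties of measurable sets and functions apply to [G] itself. *)
Lemma measurable_gsalgP d (T : measurableType d) (G : set (set T)) (A : set T) :
  sigma_algebra setT G -> G A <-> measurable (A : set (g_sigma_algebraType G)).
Proof. by move=> sG; rewrite [X in _ <-> X]/measurable /= sigma_algebra_id. Qed.

Lemma G_measurable_fun d (T : measurableType d) (R : realType)
    (G : set (set T)) (g : T -> R) : G `<=` measurable ->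
  G_measurable G g -> measurable_fun setT g.
Proof. by move=> sub mg _ B mB; rewrite setTI; exact/sub/mg. Qed.

Lemma integrable_mul_bounded d (T : measurableType d) (R : realType)
    (P : probability T R) (C : R) (g X : T -> R) :
  measurable_fun setT g -> (forall x, 0 <= g x <= C) ->
  P.-integrable setT (EFin \o X) ->
  P.-integrable setT (EFin \o (fun x => g x * X x)).
Proof.
move=> mg g0C iX.
have mX : measurable_fun setT X by apply/measurable_EFinP; exact: measurable_int iX.
apply: (le_integrable _ _ _ (integrableZl _ C iX)) => //.
  by apply/measurable_EFinP; exact: measurable_funM.
move=> x _; have /andP[g0 gC] := g0C x; rewrite /= lee_fin !normrM.
by rewrite ler_wpM2r // !ger0_norm //; exact: le_trans gC.
Qed.

Lemma integrable_bounded d (T : measurableType d) (R : realType)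
    (P : probability T R) (C : R) (g : T -> R) :
  measurable_fun setT g -> (forall x, 0 <= g x <= C) ->
  P.-integrable setT (EFin \o g).
Proof.
move=> mg g0C.
have := integrable_mul_bounded mg g0C (finite_measure_integrable_cst P 1 measurableT).
by apply: eq_integrable => // x _ /=; rewrite mulr1.
Qed.

(* Peeling off one layer [eps * 1_{eps <= g}] lowers the bound on [g] by [eps]
   at no cost, until [g <= eps]. *)
Lemma Rintegral_mul_layer d (T : measurableType d) (R : realType)
    (P : probability T R) (G : set (set T)) (X : T -> R) (eps : R) (N : nat)
    (g : T -> R) :
  sigma_algebra setT G -> G `<=` measurable ->
  P.-integrable setT (EFin \o X) ->
  (forall A, G A -> 0 <= \int[P]_(x in A) X x) ->
  G_measurable G g -> 0 < eps -> (forall x, 0 <= g x <= N.+1%:R * eps) ->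
  - (eps * \int[P]_x `|X x|) <= \int[P]_x (g x * X x).
Proof.
move=> sG subG iX X0 mg e0; elim: N g mg => [|N IH] g mg gb.
  (* Base case: [0 <= g <= eps] bounds the integral of [g X] by [eps] times that of [|X|]. *)
  have mg' := G_measurable_fun subG mg.
  have i2 := integrable_mul_bounded mg' gb iX.
  have : `|\int[P]_x (g x * X x)| <= eps * \int[P]_x `|X x|; last first.
    by rewrite ler_norml => /andP[].
  apply: le_trans (le_normr_Rintegral _ i2) _ => //.
  have iaX : P.-integrable setT (EFin \o (fun x => `|X x|)).
    exact: integrable_norm.
  rewrite -RintegralZl //; apply: le_Rintegral => //.
  - exact: integrable_norm.
  - exact: (integrableZl measurableT eps iaX).
  - move=> x _; have /andP[g0 gC] := gb x.
    by rewrite normrM ler_wpM2r // ger0_norm // -[eps]mul1r.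
(* The set [A] below belongs to [G], so the layer removed from [g] contributes [eps] times the
   integral of [X] over [A], which is nonnegative. *)
pose r x := if eps <= g x then g x - eps else g x.
pose A := [set x | eps <= g x].
have gT := (G_measurableP g sG).1 mg.
have GA : G A.
  have -> : A = g @^-1` `[eps, +oo[ by apply/seteqP; split=> x /=; rewrite in_itv /= andbT.
  exact: mg.
have mr : G_measurable G r.
  apply/(G_measurableP _ sG); apply: measurable_fun_ifT => //.
    exact: measurable_fun_ler.
  exact: measurable_funB.
have rb x : 0 <= r x <= N.+1%:R * eps.
  rewrite /r; have /andP[g0 gC] := gb x; case: ifPn => h.
    rewrite subr_ge0 h /=; rewrite -natr1 mulrDl mul1r in gC; lra.
  rewrite g0 /=; move: h; rewrite -ltNge => /ltW h; apply: le_trans h _.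
  by rewrite ler_peMl ?(ltW e0) // ler1n.
apply: le_trans (IH _ mr rb) _.
have ir := integrable_mul_bounded (G_measurable_fun subG mr) rb iX.
have mA := subG _ GA.
have iA : P.-integrable setT (EFin \o (X \_ A)).
  rewrite -restrict_EFin -integrable_mkcond //; exact: integrableS iX.
have -> : \int[P]_x (g x * X x) = \int[P]_x (r x * X x + eps * (X \_ A) x).
  apply: eq_Rintegral => x _; rewrite patchE /r /A.
  have [h|h] := boolP (eps <= g x).
    rewrite mem_set //=; ring.
  by rewrite memNset //= ?mulr0 ?addr0 //; apply/negP.
rewrite RintegralD //; last exact: (integrableZl measurableT eps iA).
rewrite RintegralZl // -Rintegral_mkcond lerDl mulr_ge0 ?(ltW e0) //.
exact: X0.
Qed.

(** The error [eps K] in [Rintegral_mul_layer] does not depend on the number of layers, so [eps] may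
    tend to 0. Thus [E[X | G] >= 0], expressed only through integrals over sets of [G], yields
    [E[g X] >= 0]. *)
Lemma Rintegral_mul_ge0 d (T : measurableType d) (R : realType)
    (P : probability T R) (G : set (set T)) (X : T -> R) (C : R)
    (g : T -> R) :
  sigma_algebra setT G -> G `<=` measurable ->
  P.-integrable setT (EFin \o X) ->
  (forall A, G A -> 0 <= \int[P]_(x in A) X x) ->
  G_measurable G g -> (forall x, 0 <= g x <= C) ->
  0 <= \int[P]_x (g x * X x).
Proof.
move=> sG subG iX X0 mg gb.
set I := Rintegral _ _ _; set K := \int[P]_x `|X x|.
have K0 : 0 <= K by apply: Rintegral_ge0.
have H e : 0 < e -> - (e * K) <= I.
  move=> e0; apply: (@Rintegral_mul_layer _ _ _ _ G _ _ (Num.trunc (C / e))) => //.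
  move=> x; have /andP[-> gC] := gb x; apply: le_trans gC _.
  by rewrite -ler_pdivrMr // ltW // truncnS_gt.
rewrite leNgt; apply/negP => I0.
(* For [e = - I / (K + 1)] one has [- e K = I + e > I], a contradiction; the added 1 covers
   [K = 0]. *)
have e0 : 0 < - I / (K + 1) by rewrite divr_gt0 ?oppr_gt0 //; lra.
have := H _ e0.
have : - I / (K + 1) * (K + 1) = - I by rewrite divfK // gt_eqF //; lra.
by lra.
Qed.

(** * The exponential supermartingale and its maximal inequality *)

Definition exp_prod (T : Type) (R : realType) (U D : nat -> T -> R) (k : nat)
    (x : T) : R :=
  \prod_(1 <= i < k.+1) (U i x * expR (- D i x)).

Definition hit (T : Type) (H : nat -> set T) (k : nat) : set T :=
  [set x | exists i, (1 <= i <= k)%N /\ H i x].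

Lemma exp_prodS (T : Type) (R : realType) (U D : nat -> T -> R) k x :
  exp_prod U D k.+1 x = exp_prod U D k x * (U k.+1 x * expR (- D k.+1 x)).
Proof. by rewrite /exp_prod big_nat_recr. Qed.

Lemma hit0 (T : Type) (H : nat -> set T) : hit H 0 = set0.
Proof. by apply/seteqP; split=> // x [[|i] []]. Qed.

Lemma hitS (T : Type) (H : nat -> set T) k : hit H k.+1 = hit H k `|` H k.+1.
Proof.
apply/seteqP; split=> x.
  move=> [i [/andP[i1]]]; rewrite leq_eqVlt => /orP[/eqP ->|ik] Hi; first by right.
  by left; exists i; rewrite i1.
move=> [[i [/andP[i1 ik] Hi]]|Hk]; last by exists k.+1; rewrite /= leqnn.
by exists i; rewrite i1 leqW.
Qed.

(* The process frozen at [theta] from the first passage of [exp_prod U D]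
   above [theta] on is a supermartingale. *)
Lemma maximal_ineq d (T : measurableType d) (R : realType)
    (P : probability T R) (n : nat) (F : nat -> set (set T))
    (U D : nat -> T -> R) (C theta : R) :
  let H := hit (fun i => [set x | theta <= exp_prod U D i x]) n in
  is_filtration n F -> 0 <= C -> 0 < theta ->
  (forall i, (1 <= i <= n)%N -> G_measurable (F i) (U i)) ->
  (forall i x, (1 <= i <= n)%N -> 0 <= U i x <= C) ->
  (forall i, (1 <= i <= n)%N -> G_measurable (F i.-1) (D i)) ->
  (forall i x, (1 <= i <= n)%N -> 0 <= D i x) ->
  (forall i, (1 <= i <= n)%N -> P.-integrable setT (EFin \o D i)) ->
  (forall i A, (1 <= i <= n)%N -> F i.-1 A ->
     0 <= \int[P]_(x in A) (1 + D i x - U i x)) ->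
  measurable H /\ (P H <= (theta^-1)%:E)%E.
Proof.
move=> H0 [F0 sF subF incF] C0 th0 mU Ub mD Db iD condF; rewrite {}/H0.
pose H i := [set x | theta <= exp_prod U D i x]; rewrite -/H.
have up k (g : T -> R) : (k < n)%N -> G_measurable (F k) g -> G_measurable (F k.+1) g.
  by move=> kn mg B mB; apply: (incF _ kn); exact: mg.
have eD k x : (k < n)%N -> 0 <= expR (- D k.+1 x) <= 1.
  by move=> kn; rewrite expR_ge0 -expR0 ler_expR oppr_le0 Db.
have mZ k : (k <= n)%N -> G_measurable (F k) (exp_prod U D k).
  elim: k => [|k IH] kn.
    apply/(G_measurableP _ (sF _ kn)).
    have -> : exp_prod U D 0 = fun _ => 1.
      by apply/funext => x; rewrite /exp_prod big_geq.
    exact: measurable_cst.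
  have -> : exp_prod U D k.+1 =
      fun x => exp_prod U D k x * (U k.+1 x * expR (- D k.+1 x)).
    by apply/funext => x; rewrite exp_prodS.
  have h1 := (G_measurableP _ (sF _ kn)).1 (up _ _ kn (IH (ltnW kn))).
  have h2 := (G_measurableP _ (sF _ kn)).1 (mU k.+1 kn).
  have h3 := (G_measurableP _ (sF _ kn)).1 (up _ _ kn (mD k.+1 kn)).
  apply/(G_measurableP _ (sF _ kn)).
  apply: measurable_funM => //; apply: measurable_funM => //.
  by apply: measurableT_comp => //; exact: measurableT_comp.
have FH i : (1 <= i <= n)%N -> F i (H i).
  move=> /andP[_ kn].
  have -> : H i = exp_prod U D i @^-1` `[theta, +oo[.
    by apply/seteqP; split=> x /=; rewrite in_itv /= andbT.
  exact: mZ.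
have mhit k : (k <= n)%N -> F k (hit H k).
  elim: k => [|k IH] kn.
    by rewrite hit0; case: (sF _ kn).
  rewrite hitS; apply/(measurable_gsalgP _ (sF _ kn)); apply: measurableU.
    by apply/(measurable_gsalgP _ (sF _ kn)); apply: (incF _ kn); exact/IH/ltnW.
  by apply/(measurable_gsalgP _ (sF _ kn)); apply: FH; rewrite kn.
have Zb k x : (k <= n)%N -> 0 <= exp_prod U D k x <= C ^+ k.
  elim: k => [|k IH] kn; first by rewrite /exp_prod big_geq // ler01 lexx.
  have /andP[z0 zC] := IH (ltnW kn); have /andP[u0 uC] := Ub k.+1 x kn.
  have /andP[e0 e1] := eD k x kn.
  rewrite exp_prodS exprSr !mulr_ge0 //= ler_pM ?mulr_ge0 //.
  by rewrite -[leRHS]mulr1 ler_pM.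
(* [Q 0 = 1], the mean of [Q] does not increase, and [Q n >= theta] on the hitting event; Markov's
   inequality then gives the claim. *)
pose Q k x := if x \in hit H k then theta else exp_prod U D k x.
have mQ k : (k <= n)%N -> measurable_fun setT (Q k).
  move=> kn; apply: measurable_fun_ifT => //.
    apply: (measurable_fun_bool true); rewrite setTI.
    have -> : (fun x => x \in hit H k) @^-1` [set true] = hit H k.
      by apply/seteqP; split=> x; [exact: set_mem|exact: mem_set].
    exact/(subF _ kn)/mhit.
  exact: G_measurable_fun (subF _ kn) (mZ _ kn).
have Qb k x : (k <= n)%N -> 0 <= Q k x <= theta + C ^+ k.
  move=> kn; have /andP[z0 zC] := Zb k x kn; have Ck := exprn_ge0 k C0; have th := ltW th0.
  by rewrite /Q; case: ifP => _; apply/andP; split; lra.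
have iQ k : (k <= n)%N -> P.-integrable setT (EFin \o Q k).
  by move=> kn; apply: integrable_bounded (mQ _ kn) (fun x => Qb k x kn).
have EQ k : (k <= n)%N -> \int[P]_x Q k x <= 1.
  elim: k => [|k IH] kn.
    have -> : \int[P]_x Q 0 x = \int[P]_x (cst 1 x).
      by apply: eq_Rintegral => x _; rewrite /Q hit0 in_set0 /exp_prod big_geq.
    by rewrite Rintegral_cst //= probability_setT mul1r.
  have kn' := ltnW kn.
  apply: le_trans (IH kn').
  (* The drop of [Q] from [k] to [k + 1] is at least [g * X], where [g] is known at time [k] and
     vanishes after the passage, and [X] has nonnegative conditional mean by [condF]. *)
  pose g x := if x \in hit H k then 0 else exp_prod U D k x * expR (- D k.+1 x).
  pose X x := 1 + D k.+1 x - U k.+1 x.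
  have sk := sF _ kn'.
  have mg : G_measurable (F k) g.
    apply/(G_measurableP _ sk); apply: measurable_fun_ifT => //.
      apply: (measurable_fun_bool true); rewrite setTI.
      have -> : (fun x => x \in hit H k) @^-1` [set true] = hit H k.
        by apply/seteqP; split=> x; [exact: set_mem|exact: mem_set].
      exact/(measurable_gsalgP _ sk)/mhit.
    apply: measurable_funM; first exact/(G_measurableP _ sk)/mZ.
    apply: measurableT_comp => //; apply: measurableT_comp => //.
    exact/(G_measurableP _ sk)/(mD k.+1 kn).
  have gb x : 0 <= g x <= C ^+ k.
    have /andP[z0 zC] := Zb k x kn'; have /andP[e0 e1] := eD k x kn.
    rewrite /g; case: ifP => _; first by rewrite lexx exprn_ge0.
    by rewrite mulr_ge0 //= -[leRHS]mulr1 ler_pM.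
  have iU : P.-integrable setT (EFin \o U k.+1).
    apply: (@integrable_bounded _ _ _ _ C) => [|x]; last exact: Ub.
    exact: G_measurable_fun (subF _ kn) (mU k.+1 kn).
  have iX : P.-integrable setT (EFin \o X).
    have i1 := integrableD measurableT
      (finite_measure_integrable_cst P 1 measurableT) (iD k.+1 kn).
    exact: (integrableB measurableT i1 iU).
  have igX : P.-integrable setT (EFin \o (fun x => g x * X x)).
    exact: integrable_mul_bounded (G_measurable_fun (subF _ kn') mg) gb iX.
  have gX0 : 0 <= \int[P]_x (g x * X x).
    apply: (Rintegral_mul_ge0 sk (subF _ kn') iX _ mg gb) => A FA.
    exact: condF.
  apply: (@le_trans _ _ (\int[P]_x (Q k x - g x * X x))); last first.
    by rewrite RintegralB //; [lra | exact: iQ].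
  apply: le_Rintegral => //; first exact: iQ.
    exact: (integrableB measurableT (iQ _ kn') igX).
  move=> x _; rewrite /Q /g hitS in_setU.
  have [hx|_] /= := boolP (x \in hit H k); first by rewrite mul0r subr0.
  (* As [(1 + D) e^(- D) <= 1], the new factor [U e^(- D)] is at most [1 - e^(- D) (1 + D - U)]. *)
  have : exp_prod U D k.+1 x <=
      exp_prod U D k x - exp_prod U D k x * expR (- D k.+1 x) * X x.
    have /andP[z0 _] := Zb k x kn'; have /andP[e0 _] := eD k x kn.
    rewrite exp_prodS /X -mulrA -[X in _ <= X - _]mulr1 -mulrBr ler_wpM2l //.
    have := ler_wpM2l e0 (expR_ge1Dx (D k.+1 x)).
    by rewrite -expRD addNr expR0; lra.
  (* At the first passage [exp_prod] is at least [theta], so freezing at [theta] can only lower the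
     process. *)
  case: ifP => [|_ //]; rewrite in_setE => hx.
  by apply: le_trans; exact: hx.
have mh : measurable (hit H n) by apply: (subF _ (leqnn n)); exact: mhit.
split=> //.
rewrite -(@fineK _ (P _)) ?fin_num_measure // lee_fin -[leRHS]mul1r.
rewrite ler_pdivlMr // mulrC.
apply: le_trans (EQ n (leqnn n)).
have -> : fine (P (hit H n)) = \int[P]_x \1_(hit H n) x.
  by rewrite /Rintegral integral_indic // setIT.
have ii := integrable_indic P mh.
rewrite -RintegralZl //.
apply: le_Rintegral => //; [exact: (integrableZl measurableT theta ii)|exact: iQ|].
move=> x _; rewrite indicE /Q; case: ifP => _; first by rewrite mulr1.
by rewrite mulr0; have /andP[] := Zb n x (leqnn n).
Qed.

(** * Conditional moments and the conditional bound on the exponential *)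

Lemma cond_exp_ge0 d (T : measurableType d) (R : realType)
    (P : probability T R) (G : set (set T)) (f g : T -> R) :
  G `<=` measurable -> cond_exp_version P G f g -> (forall x, 0 <= f x) ->
  P [set x | g x < 0] = 0%E.
Proof.
move=> subG [mg ig gf] f0; set A := [set x | g x < 0].
have GA : G A.
  have -> : A = g @^-1` `]-oo, 0[ by apply/seteqP; split=> x /=; rewrite in_itv.
  exact: mg.
have mA := subG _ GA.
have igA : P.-integrable A (EFin \o g) by exact: integrableS ig.
(* On [A] one has [|g| = - g], and [A] lies in [G], so the integral of [|g|] is minus that of
   [f >= 0]. Hence [g = 0] almost everywhere on [A], which forces [A] to be null. *)
have abs0 : (\int[P]_(x in A) `|(EFin \o g) x| = 0)%E.
  have e : (\int[P]_(x in A) `|(EFin \o g) x| = (-1)%:E * \int[P]_(x in A) (g x)%:E)%E.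
    rewrite -integralZl //; apply: eq_integral => x; rewrite in_setE /A /= => gx.
    by rewrite -EFinM mulN1r ltr0_norm.
  apply/eqP; rewrite eq_le; apply/andP; split; last exact: integral_ge0.
  rewrite e gf // EFinN mulN1e oppe_le0; apply: integral_ge0 => x _.
  by rewrite lee_fin.
have /(ae_eq_integral_abs P mA (measurable_int _ igA))[N [mN PN subN]] := abs0.
apply/negligibleP => //; exists N; split => //.
apply: subset_trans subN => x /= gx h.
by have [] := h gx; move=> g0; move: gx; rewrite /A /= g0 ltxx.
Qed.

Lemma Rintegral_affine3 d (T : measurableType d) (R : realType)
    (P : probability T R) (A : set T) (k1 k2 k3 : R) (f1 f2 f3 : T -> R) :
  measurable A ->
  P.-integrable A (EFin \o f1) -> P.-integrable A (EFin \o f2) ->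
  P.-integrable A (EFin \o f3) ->
  P.-integrable A (EFin \o (fun x => 1 + k1 * f1 x + k2 * f2 x + k3 * f3 x)) /\
  \int[P]_(x in A) (1 + k1 * f1 x + k2 * f2 x + k3 * f3 x) =
  fine (P A) + k1 * \int[P]_(x in A) f1 x + k2 * \int[P]_(x in A) f2 x
    + k3 * \int[P]_(x in A) f3 x.
Proof.
move=> mA i1 i2 i3.
have j0 := finite_measure_integrable_cst P 1 mA.
have j1 := integrableZl mA k1 i1; have j2 := integrableZl mA k2 i2.
have j3 := integrableZl mA k3 i3.
have s1 := integrableD mA j0 j1; have s2 := integrableD mA s1 j2.
split; first exact: (integrableD mA s2 j3).
rewrite (RintegralD mA s2 j3) (RintegralD mA s1 j2) (RintegralD mA j0 j1).
by rewrite !RintegralZl // Rintegral_cst // mul1r.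
Qed.

(** Domination by [1 + |X|^p]; the constant 1 lets the bound cover [X^2] as well as the power
    [p]. *)
Lemma integrable_le_powR d (T : measurableType d) (R : realType)
    (P : probability T R) (p : R) (X f : T -> R) :
  measurable_fun setT X ->
  (\int[P]_x (`|X x| `^ p)%:E < +oo)%E ->
  measurable_fun setT f -> (forall x, 0 <= f x <= 1 + `|X x| `^ p) ->
  P.-integrable setT (EFin \o f).
Proof.
move=> mX pX mf fb.
have iX : P.-integrable setT (EFin \o (fun x => `|X x| `^ p)).
  apply/integrableP; split.
    apply/measurable_EFinP.
    apply: (measurableT_comp (measurable_powR p)); exact: measurableT_comp.
  under eq_integral do rewrite /= ger0_norm ?powR_ge0 //.
  exact: pX.
apply: (le_integrable measurableT _ _
  (integrableD measurableT (finite_measure_integrable_cst P 1 measurableT) iX)).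
  exact/measurable_EFinP.
move=> x _; have /andP[f0 fX] := fb x.
by rewrite /= lee_fin ger0_norm // ger0_norm // (le_trans f0 fX).
Qed.

Lemma sqr_le_powR (R : realType) (p t : R) : 2 <= p -> t ^+ 2 <= 1 + `|t| `^ p.
Proof.
move=> p2; rewrite -(real_normK (num_real t)).
have [h|h] := leP `|t| 1.
  have : `|t| ^+ 2 <= 1 by rewrite expr_le1.
  have := powR_ge0 `|t| p; lra.
have : `|t| `^ 2 <= `|t| `^ p by apply: ler_powR => //; exact: ltW.
by rewrite powR_mulrn //; lra.
Qed.

Lemma integrable_max0 d (T : measurableType d) (R : realType)
    (P : probability T R) (f : T -> R) :
  P.-integrable setT (EFin \o f) ->
  P.-integrable setT (EFin \o (fun x => Num.max (f x) 0)).
Proof.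
move=> fi; apply: (le_integrable measurableT _ _ fi).
  apply/measurable_EFinP/measurable_maxr => //.
  by apply/measurable_EFinP; exact: measurable_int fi.
move=> x _; rewrite /= lee_fin ger0_norm ?le_max ?lexx ?orbT //.
by rewrite ge_max normr_ge0 ler_norm.
Qed.

(** Integrate [expR_trunc_le] over [A]: since [A] lies in [G], the linear term vanishes and the two
    moments turn into [V] and [W]. As [c1, c2 >= 0], passing to positive parts only increases the
    bound. *)
Lemma cond_laplace_bound d (T : measurableType d) (R : realType)
    (P : probability T R) (G : set (set T)) (X V W : T -> R) (p y l : R) :
  let c1 := l ^+ 2 * expR p / 2 in let c2 := tail_coef p y l in
  2 <= p -> 0 < y -> 0 < l -> G `<=` measurable ->
  P.-integrable setT (EFin \o X) ->
  (\int[P]_x (`|X x| `^ p)%:E < +oo)%E ->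
  cond_exp_version P G X (fun _ => 0) ->
  cond_exp_version P G (fun x => X x ^+ 2) V ->
  cond_exp_version P G (fun x => Num.max (X x) 0 `^ p) W ->
  forall A, G A ->
  0 <= \int[P]_(x in A) (1 + (c1 * Num.max (V x) 0 + c2 * Num.max (W x) 0)
         - expR (l * (if X x <= y then X x else 0))).
Proof.
move=> c1 c2 p2 y0 l0 subG iX pX [_ i0 X0] [_ iV VX] [_ iW WX] A GA.
have mA := subG _ GA.
have mX : measurable_fun setT X by apply/measurable_EFinP; exact: measurable_int iX.
have c10 : 0 <= c1 by rewrite divr_ge0 // mulr_ge0 ?sqr_ge0 ?expR_ge0.
have c20 : 0 <= c2 by exact: tail_coef_ge0.
have iX2 : P.-integrable setT (EFin \o (fun x => X x ^+ 2)).
  apply: (integrable_le_powR mX pX); first exact: measurable_funX.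
  by move=> x; rewrite sqr_ge0 sqr_le_powR.
have iXp : P.-integrable setT (EFin \o (fun x => Num.max (X x) 0 `^ p)).
  apply: (integrable_le_powR mX pX).
    by apply: (measurableT_comp (measurable_powR p)); exact: measurable_maxr.
  move=> x; rewrite powR_ge0 /=.
  have : Num.max (X x) 0 `^ p <= `|X x| `^ p.
    apply: ge0_ler_powR; rewrite ?nnegrE ?le_max ?lexx ?orbT //; first lra.
    by rewrite ge_max normr_ge0 ler_norm.
  lra.
have iU : P.-integrable setT
    (EFin \o (fun x => expR (l * (if X x <= y then X x else 0)))).
  apply: (@integrable_bounded _ _ _ _ (expR (l * y))).
    apply: measurableT_comp => //; apply: measurable_funM => //.
    by apply: measurable_fun_ifT => //; exact: measurable_fun_ler.
  move=> x; rewrite expR_ge0 ler_expR ler_pM2l //.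
  by case: ifP => // _; exact: ltW.
have onA (f : T -> R) : P.-integrable setT (EFin \o f) -> P.-integrable A (EFin \o f).
  by move=> fi; exact: integrableS fi.
have [k1 e1] := Rintegral_affine3 l c1 c2 mA (onA _ iX) (onA _ iX2) (onA _ iXp).
have [k2 e2] := Rintegral_affine3 l c1 c2 mA (onA _ i0) (onA _ iV) (onA _ iW).
(* The coefficient 0 removes the linear term; only integrability is taken from this instance. *)
have [k3 _] := Rintegral_affine3 0 c1 c2 mA (onA _ i0) (onA _ (integrable_max0 iV))
  (onA _ (integrable_max0 iW)).
have kE : P.-integrable A
    (EFin \o (fun x => 1 + (c1 * Num.max (V x) 0 + c2 * Num.max (W x) 0))).
  by move: k3; apply: eq_integrable => // x _ /=; rewrite mul0r addr0 addrA.
rewrite RintegralB //; last exact: onA.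
rewrite subr_ge0.
apply: (@le_trans _ _ (\int[P]_(x in A)
  (1 + l * X x + c1 * X x ^+ 2 + c2 * Num.max (X x) 0 `^ p))).
  by apply: le_Rintegral => //; [exact: onA|move=> x _; exact: expR_trunc_le].
have -> : \int[P]_(x in A)
    (1 + l * X x + c1 * X x ^+ 2 + c2 * Num.max (X x) 0 `^ p) =
    \int[P]_(x in A) (1 + l * 0 + c1 * V x + c2 * W x).
  by rewrite e1 e2 /Rintegral -X0 // -VX // -WX.
apply: le_Rintegral => // x _.
have hV : V x <= Num.max (V x) 0 by rewrite le_max lexx.
have hW : W x <= Num.max (W x) 0 by rewrite le_max lexx.
have := ler_wpM2l c10 hV; have := ler_wpM2l c20 hW; lra.
Qed.

(** * Partial sums, exceptional sets and the union bound *)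

Lemma measurable_partial_sum d (T : measurableType d) (R : realType) (n : nat)
    (f : nat -> T -> R) :
  (forall i, (1 <= i <= n)%N -> measurable_fun setT (f i)) ->
  forall k, (k <= n)%N -> measurable_fun setT (fun x => \sum_(1 <= i < k.+1) f i x).
Proof.
move=> mf; elim=> [|k IH] kn.
  by under eq_fun do rewrite big_geq //; exact: measurable_cst.
under eq_fun do rewrite big_nat_recr //=.
by apply: measurable_funD; [exact/IH/ltnW|exact: mf].
Qed.

Theorem theorem2p2 (d : measure_display) (T : measurableType d) (R : realType)
  (P : probability T R) (n : nat) (F : nat -> set (set T)) (xi : nat -> T -> R)
  (p : R) (V W : nat -> T -> R) :
  (1 <= n)%N ->
  mart_diff P n F xi ->
  2 <= p ->
  (forall i, (1 <= i <= n)%N ->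
     (\int[P]_x ((`|xi i x| `^ p)%:E) < +oo)%E) ->
  (* V i is a version of E[xi_i^2 | F_{i-1}] *)
  (forall i, (1 <= i <= n)%N ->
     cond_exp_version P (F i.-1) (fun x => xi i x ^+ 2) (V i)) ->
  (* W i is a version of E[(xi_i^+)^p | F_{i-1}] *)
  (forall i, (1 <= i <= n)%N ->
     cond_exp_version P (F i.-1) (fun x => (Num.max (xi i x) 0) `^ p) (W i)) ->
  let a := 2 / (p + 2) in
  let b := 1 - a in
  let S := fun k x => \sum_(1 <= i < k.+1) xi i x in
  let QV := fun k x => \sum_(1 <= i < k.+1) V i x in
  let Xi := fun k x => \sum_(1 <= i < k.+1) W i x in
  forall x y v w : R, 0 < x -> 0 < y -> 0 < v -> 0 < w ->
  (P [set om | exists k, (1 <= k <= n)%N /\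
        [/\ (x <= S k om)%R, (QV k om <= v)%R & (Xi k om <= w)%R]]
   <= (expR (- (a ^+ 2 * x ^+ 2) / (2 * expR p * v))
       + expR (- (b * x / y) * ln (1 + b * x * y `^ (p - 1) / w)))%:E
      + P [set om | exists i, (1 <= i <= n)%N /\ (y < xi i om)%R])%E.
Proof.
move=> n1 [fil _ mxi ixi mdxi] p2 pxi VX WX a b S QV Xi x y v w x0 y0 v0 w0.
have [F0 sF subF incF] := fil.
have [l l0 hl] := exponent_choice p2 x0 y0 v0 w0.
move: hl; set c1 := l ^+ 2 * expR p / 2; set c2 := tail_coef p y l => hl.
have c10 : 0 <= c1 by rewrite divr_ge0 // mulr_ge0 ?sqr_ge0 ?expR_ge0.
have c20 : 0 <= c2 by exact: tail_coef_ge0.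
(* Since [y > 0], the truncated variable is at most [y], so [U i <= e^(l y)]; this is the constant
   [C] of [maximal_ineq]. *)
pose U i om := expR (l * (if xi i om <= y then xi i om else 0)).
(* [V] and [W] are nonnegative only almost surely; the positive parts keep the
   supermartingale bounded everywhere. *)
pose D i om := c1 * Num.max (V i om) 0 + c2 * Num.max (W i om) 0.
(* The level that [exp_prod] reaches on the event to be bounded, off the exceptional sets;
   [exponent_choice] bounds [theta^-1]. *)
pose theta := expR (l * x - c1 * v - c2 * w).
have leP1 i : (1 <= i <= n)%N -> (i.-1 <= n)%N.
  by move=> /andP[_]; apply: leq_trans; exact: leq_pred.
have le_n i : (1 <= i <= n)%N -> (i <= n)%N by case/andP.
have mX i : (1 <= i <= n)%N -> measurable_fun setT (xi i).
  by move=> hi; exact: G_measurable_fun (subF _ (le_n _ hi)) (mxi i (le_n _ hi)).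
have mV i : (1 <= i <= n)%N -> measurable_fun setT (V i).
  move=> hi; have [mVi _ _] := VX i hi.
  exact: G_measurable_fun (subF _ (leP1 _ hi)) mVi.
have mW i : (1 <= i <= n)%N -> measurable_fun setT (W i).
  move=> hi; have [mWi _ _] := WX i hi.
  exact: G_measurable_fun (subF _ (leP1 _ hi)) mWi.
have D0 i om : 0 <= D i om.
  by rewrite addr_ge0 // mulr_ge0 // le_max lexx orbT.
have mU i : (1 <= i <= n)%N -> G_measurable (F i) (U i).
  move=> hi; have si := sF _ (le_n _ hi).
  have m1 := (G_measurableP _ si).1 (mxi i (le_n _ hi)).
  apply/(G_measurableP _ si); apply: measurableT_comp => //.
  apply: measurable_funM => //.
  by apply: measurable_fun_ifT => //; exact: measurable_fun_ler.
have mD i : (1 <= i <= n)%N -> G_measurable (F i.-1) (D i).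
  move=> hi; have si := sF _ (leP1 _ hi).
  have [/(G_measurableP _ si) m1 _ _] := VX i hi.
  have [/(G_measurableP _ si) m2 _ _] := WX i hi.
  apply/(G_measurableP _ si).
  by apply: measurable_funD; apply: measurable_funM => //; exact: measurable_maxr.
have iD i : (1 <= i <= n)%N -> P.-integrable setT (EFin \o D i).
  move=> hi; have [_ iV _] := VX i hi; have [_ iW _] := WX i hi.
  exact: (integrableD measurableT (integrableZl measurableT c1 (integrable_max0 iV))
    (integrableZl measurableT c2 (integrable_max0 iW))).
have UC i om : (1 <= i <= n)%N -> 0 <= U i om <= expR (l * y).
  move=> _; rewrite expR_ge0 ler_expR ler_pM2l //.
  by case: ifP => // _; exact: ltW.
have condU i A : (1 <= i <= n)%N -> F i.-1 A ->
    0 <= \int[P]_(om in A) (1 + D i om - U i om).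
  move=> hi FA; apply: (cond_laplace_bound p2 y0 l0 (subF _ (leP1 _ hi))
    (ixi i hi) (pxi i hi) (mdxi i hi) (VX i hi) (WX i hi) FA).
have [mH PH] := maximal_ineq fil (expR_ge0 (l * y)) (expR_gt0 _ : 0 < theta)
  mU UC mD (fun i om _ => D0 i om) iD condU.
set H := hit _ n in mH PH.
set E := [set om | exists k, _]; set B := [set om | exists i, _].
(* Where the chosen versions fail to be nonnegative; empty for [i] outside [[1, n]], so that the
   union over all [i] is null. *)
pose N i := if (1 <= i <= n)%N then
  [set om | V i om < 0] `|` [set om | W i om < 0] else set0.
have mlt (f : T -> R) : measurable_fun setT f -> measurable [set om | f om < 0].
  move=> mf; rewrite -[X in measurable X]setTI.
  exact: measurable_fun_ltr mf (measurable_cst _) measurableT _ _.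
have mN i : measurable (N i).
  rewrite /N; case: ifP => // hi; apply: measurableU; apply: mlt; [exact: mV|exact: mW].
have mNN : measurable (\bigcup_i N i) by exact: bigcup_measurable.
have PN : P (\bigcup_i N i) = 0%E.
  apply/negligibleP => //; apply: negligible_bigcup => i.
  rewrite /N; case: ifPn => hi; last exact: negligible_set0.
  apply: negligibleU; apply/negligibleP; try (by apply: mlt; auto).
    by apply: (cond_exp_ge0 (subF _ (leP1 _ hi)) (VX i hi)) => om; exact: sqr_ge0.
  by apply: (cond_exp_ge0 (subF _ (leP1 _ hi)) (WX i hi)) => om; exact: powR_ge0.
have mB : measurable B.
  have -> : B = \bigcup_(i in [set i | (1 <= i <= n)%N]) [set om | y < xi i om].
    by apply/seteqP; split=> om; [move=> [i [hi h]]; exists i|move=> [i hi h]; exists i].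
  apply: bigcup_measurable => i hi; rewrite -[X in measurable X]setTI.
  exact: measurable_fun_ltr (measurable_cst _) (mX _ hi) measurableT _ _.
have mE : measurable E.
  have -> : E = \bigcup_(k in [set k | (1 <= k <= n)%N])
      ([set om | x <= S k om] `&` [set om | QV k om <= v] `&` [set om | Xi k om <= w]).
    apply/seteqP; split=> om.
      by move=> [k [hk [h1 h2 h3]]]; exists k.
    by move=> [k hk [[h1 h2] h3]]; exists k.
  apply: bigcup_measurable => k /= hk; have kn := le_n _ hk.
  have mle (f g : T -> R) : measurable_fun setT f -> measurable_fun setT g ->
      measurable [set om | f om <= g om].
    move=> mf mg; rewrite -[X in measurable X]setTI.
    exact: measurable_fun_ler mf mg measurableT _ _.
  apply: measurableI; first apply: measurableI.
  - by apply: mle => //; exact: measurable_partial_sum mX _ kn.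
  - by apply: mle => //; exact: measurable_partial_sum mV _ kn.
  - by apply: mle => //; exact: measurable_partial_sum mW _ kn.
have subE : E `<=` H `|` B `|` \bigcup_i N i.
  (* Off [B] the truncation is inactive, and off the null set so are the positive parts; hence
     [exp_prod] equals [exp (l S - c1 QV - c2 Xi)], which is at least [theta]. *)
  move=> om [k [hk [hS hV hW]]].
  have [Bom|nB] := pselect (B om); first by left; right.
  have [Nom|nN] := pselect ((\bigcup_i N i) om); first by right.
  left; left; exists k; split=> //=.
  have xiy i : (1 <= i < k.+1)%N -> xi i om <= y.
    move=> /andP[i1 ik]; rewrite leNgt; apply/negP => h; apply: nB; exists i.
    by rewrite i1 (leq_trans _ (le_n _ hk)).
  have V0 i : (1 <= i < k.+1)%N -> 0 <= V i om.
    move=> /andP[i1 ik]; rewrite leNgt; apply/negP => h; apply: nN; exists i => //.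
    by rewrite /N i1 (leq_trans _ (le_n _ hk)) //; left.
  have W0 i : (1 <= i < k.+1)%N -> 0 <= W i om.
    move=> /andP[i1 ik]; rewrite leNgt; apply/negP => h; apply: nN; exists i => //.
    by rewrite /N i1 (leq_trans _ (le_n _ hk)) //; right.
  have -> : exp_prod U D k om =
      expR (l * S k om - c1 * QV k om - c2 * Xi k om).
    rewrite /S /QV /Xi !mulr_sumr -!sumrB expR_sum.
    apply: eq_big_nat => i hi; rewrite /U /D xiy //.
    rewrite (max_l (V0 _ hi)) (max_l (W0 _ hi)) -expRD; congr expR; ring.
  rewrite ler_expR.
  have := ler_wpM2l (ltW l0) hS; have := ler_wpM2l c10 hV.
  by have := ler_wpM2l c20 hW; lra.
(* Union bound: [H] gives the two exponentials through [theta^-1], [B] gives the last probability,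
   and the remaining set is null. *)
apply: (@le_trans _ _ (P (H `|` B `|` \bigcup_i N i))).
  by apply: le_measure; rewrite ?inE //; do !apply: measurableU.
apply: (le_trans (measureU2 P (measurableU _ _ mH mB) mNN)).
rewrite -[leRHS]adde0; apply: leeD; last by rewrite le_eqVlt; apply/orP; left; apply/eqP; exact: PN.
apply: (le_trans (measureU2 P mH mB)).
rewrite leeD2r //; apply: (le_trans PH); rewrite lee_fin /theta -expRN.
exact: hl.
Qed.
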